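(* Let $\pi$ be a non-empty set of primes and let $G$ be a relatively free nilpotent $\pi$-torsion-free group. Then $G$ is geometrically equivalent to its $\pi$-completion $\widehat{G}^\pi$.
   Context: A $\pi$-number is an integer that is a product of powers of primes from $\pi$. A group $G$ is $\pi$-torsion-free if for every $\pi$-number $n$ the equation $x^n=1$ has only the trivial solution in $G$; it is $\pi$-divisible if for every $\pi$-number $n$ and every $a\in G$ the equation $x^n=a$ has a solution in $G$; it is $\pi$-complete if it is both $\pi$-divisible and $\pi$-torsion-free. A relatively free group is a free group of some variety of groups, i.e. a group isomorphic to $F/V$ with $F$ a free group and $V$ a verbal subgroup of $F$. A relatively free nilpotent $\pi$-torsion-free group is a relatively free group that is nilpotent and $\pi$-torsion-free; such groups arise as $F_n/H$, where $F_n$ is a relatively free $n$-step nilpotent group and $H$ is a verbal subgroup of $F_n$ that is $\pi$-isolated (i.e. $g\in F_n$ and $g^k\in H$ for some $\pi$-number $k$ imply $g\in H$). The $\pi$-completion $\widehat{G}^\pi$ of a $\pi$-torsion-free nilpotent group $G$ is the minimal $\pi$-complete nilpotent group containing $G$. It exists, is unique up to isomorphism, and is characterized as a $\pi$-complete nilpotent group containing $G$ in which every element $g$ satisfies $g^m\in G$ for some $\pi$-number $m$. It is regarded as an abstract group (only the usual group operations). Geometric equivalence: for a free group $F=F(X)$ on a finite set $X$, a group $G$ and a subset $T\subseteq F$, put $T'_G=\{\varphi\in\mathrm{Hom}(F,G) : T\subseteq \mathrm{Ker}\,\varphi\}$ and $T''_G=\bigcap_{\varphi\in T'_G}\mathrm{Ker}\,\varphi$.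 Two groups $G_1,G_2$ are geometrically equivalent if $T''_{G_1}=T''_{G_2}$ for every free group $F$ of finite rank and every subset $T\subseteq F$. *)

(* Defs.v *)
From HB Require Import structures.
From mathcomp Require Import all_boot.
From mathcomp Require Import boolp classical_sets.

Set Implicit Arguments.
Unset Strict Implicit.
Unset Printing Implicit Defensive.

Local Open Scope group_scope.
Local Open Scope classical_set_scope.

Notation hom G H := (UMagmaMorphism.type G H).

Definition ker (G H : groupType) (f : hom G H) : set G := [set x | f x = 1].

(** The letter [(x, false)] stands for [x] and [(x, true)] for [x^-1]; the
    elements of the free group on [X] are the reduced words. *)
Section FreeGroup.
Variable X : choiceType.
Implicit Types (a b : X * bool) (u v w : seq (X * bool)).

Definition letter_inv a := (a.1, ~~ a.2).

Definition reduced w := sorted (fun a b => b != letter_inv a) w.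

Definition push a w :=
  if w is b :: w' then if b == letter_inv a then w' else a :: w else [:: a].

Definition word_mul u v := foldr push v u.

Definition word_inv w := rev (map letter_inv w).

Lemma letter_invK : involutive letter_inv.
Proof. by case=> x b; rewrite /letter_inv /= negbK. Qed.

Lemma push_reduced a w : reduced w -> reduced (push a w).
Proof.
case: w => [//|b w] /= rw; case: eqP => [_|/eqP ab]; first exact: path_sorted rw.
by rewrite /= ab.
Qed.

Lemma word_mul_reduced u v : reduced v -> reduced (word_mul u v).
Proof. by move=> rv; elim: u => //= a u /push_reduced. Qed.

Lemma push_cons a w : reduced (a :: w) -> push a w = a :: w.
Proof. by case: w => //= b w /andP[/negbTE ->]. Qed.

Lemma pushK a w : reduced w -> push (letter_inv a) (push a w) = w.
Proof.
case: w => [|b w] /= rw; first by rewrite letter_invK eqxx.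
case: eqP => [<-|_] /=; last by rewrite letter_invK eqxx.
exact: push_cons.
Qed.

Lemma pushVK a w : reduced w -> push a (push (letter_inv a) w) = w.
Proof. by move=> rw; rewrite -{1}[a]letter_invK pushK. Qed.

Lemma word_mul_push a v w :
  reduced w -> word_mul (push a v) w = push a (word_mul v w).
Proof.
case: v => [//|b v] rw /=; case: eqP => [->|_] //.
by rewrite pushVK //; apply: word_mul_reduced.
Qed.

Lemma word_mulA u v w :
  reduced w -> word_mul u (word_mul v w) = word_mul (word_mul u v) w.
Proof. by move=> rw; elim: u => //= a u ->; rewrite word_mul_push. Qed.

Lemma word_mulw1 w : reduced w -> word_mul w [::] = w.
Proof.
elim: w => //= a w IHw rw; rewrite IHw; last exact: path_sorted rw.
exact: push_cons.
Qed.

Lemma word_inv_reduced w : reduced w -> reduced (word_inv w).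
Proof.
rewrite /reduced /word_inv rev_sorted sorted_map.
apply: sub_sorted => a b /=; apply: contraNN => /eqP.
by move=> /(inv_inj letter_invK) ->; rewrite letter_invK.
Qed.

Lemma word_invK : involutive word_inv.
Proof. by move=> w; rewrite /word_inv map_rev revK (mapK letter_invK). Qed.

Lemma word_mulVw w : word_mul (word_inv w) w = [::].
Proof.
suff H v : reduced v -> word_mul (word_inv w) (word_mul w v) = v.
  rewrite -[in X in word_mul _ X = _](cats0 w).
  elim: w {H} => //= a w IHw; rewrite /word_inv /= rev_cons -cats1.
  by rewrite /word_mul foldr_cat /= letter_invK eqxx; apply: IHw.
elim: w v => [//|a w IHw] v rv /=.
rewrite /word_inv /= rev_cons -cats1 /word_mul foldr_cat /= pushK.
  exact: IHw.
exact: word_mul_reduced.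
Qed.

Record free_group := FreeGroup { word :> seq (X * bool); wordP : reduced word }.

HB.instance Definition _ := [isSub for word].
HB.instance Definition _ := [Choice of free_group by <:].

Definition fg_one : free_group := @FreeGroup [::] isT.
Definition fg_mul (u v : free_group) : free_group :=
  FreeGroup (word_mul_reduced u (wordP v)).
Definition fg_inv (u : free_group) : free_group :=
  FreeGroup (word_inv_reduced (wordP u)).

Lemma fg_mulA : associative fg_mul.
Proof. by move=> u v w; apply: val_inj; apply: word_mulA (wordP w). Qed.
Lemma fg_mul1 : left_id fg_one fg_mul.
Proof. by move=> u; apply: val_inj. Qed.
Lemma fg_mulr1 : right_id fg_one fg_mul.
Proof. by move=> u; apply: val_inj; apply: word_mulw1 (wordP u). Qed.
Lemma fg_mulV : left_inverse fg_one fg_inv fg_mul.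
Proof. by move=> u; apply: val_inj; apply: word_mulVw. Qed.
Lemma fg_mulrV : right_inverse fg_one fg_inv fg_mul.
Proof.
move=> u; apply: val_inj => /=.
by rewrite -{1}[word u]word_invK word_mulVw.
Qed.

HB.instance Definition _ :=
  isGroup.Build free_group fg_mulA fg_mul1 fg_mulr1 fg_mulV fg_mulrV.

Definition fg_gen (x : X) : free_group := @FreeGroup [:: (x, false)] isT.

Section UniversalProperty.
Variables (G : groupType) (f : X -> G).

Definition letter_val a : G := if a.2 then (f a.1)^-1 else f a.1.
Definition word_val w : G := \prod_(a <- w) letter_val a.

Lemma letter_valV a : letter_val (letter_inv a) = (letter_val a)^-1.
Proof. by case: a => x [] //=; rewrite /letter_val /= invgK. Qed.

Lemma word_val_push a w : word_val (push a w) = letter_val a * word_val w.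
Proof.
rewrite /word_val; case: w => [|b w] /=; first by rewrite big_seq1 big_nil mulg1.
case: eqP => [->|_]; last by rewrite big_cons.
by rewrite big_cons letter_valV mulVKg.
Qed.

Definition fg_lift (u : free_group) : G := word_val u.

Lemma fg_lift_morph : monoid_morphism fg_lift.
Proof.
split=> [|u v]; first by rewrite /fg_lift /word_val big_nil.
rewrite /fg_lift /=; elim: (word u) => [|a w IHw] /=.
  by rewrite /word_val big_nil mul1g.
by rewrite word_val_push IHw mulgA /word_val big_cons.
Qed.

HB.instance Definition _ :=
  isUMagmaMorphism.Build free_group G fg_lift fg_lift_morph.

Lemma fg_lift_gen x : fg_lift (fg_gen x) = f x.
Proof. by rewrite /fg_lift /word_val big_seq1. Qed.

Lemma fg_lift_unique (phi : hom free_group G) :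
  (forall x, phi (fg_gen x) = f x) -> phi =1 fg_lift.
Proof.
move=> phif [w rw]; rewrite /fg_lift /=; elim: w rw => [|[x b] w IHw] rw.
  by rewrite /word_val big_nil -[RHS](@gmulf1 _ _ phi); congr (phi _); apply: val_inj.
have rw' : reduced w by exact: path_sorted rw.
have -> : FreeGroup rw = (if b then (fg_gen x)^-1 else fg_gen x) * FreeGroup rw'.
  by apply: val_inj; rewrite -[LHS](push_cons rw); case: (b).
by rewrite gmulfM IHw /word_val big_cons; case: (b); rewrite ?gmulfV phif.
Qed.

End UniversalProperty.
End FreeGroup.

Definition subgroup (G : groupType) (H : set G) : Prop :=
  [/\ H 1, forall x y, H x -> H y -> H (x * y) & forall x, H x -> H x^-1].

Definition generated (G : groupType) (A : set G) : set G := smallest (@subgroup G) A.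

(** Laws are words in countably many variables. *)
Definition verbal (G : groupType) (W : set (free_group nat)) : set G :=
  generated [set g | exists (phi : hom (free_group nat) G) w, W w /\ g = phi w].
Arguments verbal : clear implicits.

(** [G] is isomorphic to [F / V] with [F] free and [V] verbal in [F]: there is an
    epimorphism from [F] to [G] with kernel [V]. *)
Definition relatively_free (G : groupType) : Prop :=
  exists (X : choiceType) (W : set (free_group nat)) (p : hom (free_group X) G),
    (forall g, exists u, p u = g) /\ ker p = verbal (free_group X) W.

Fixpoint lower_central (G : groupType) (H : set G) (n : nat) : set G :=
  if n is n'.+1 then
    generated [set g | exists x y, [/\ lower_central H n' x, H y & g = [~ x, y]]]
  else H.

Definition nilpotent (G : groupType) (H : set G) : Prop :=
  exists n, lower_central H n = [set 1].

Definition pi_torsion_free (pi : nat_pred) (G : groupType) (H : set G) : Prop :=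
  forall n x, pi.-nat n -> H x -> x ^+ n = 1 -> x = 1.

Definition pi_divisible (pi : nat_pred) (G : groupType) (H : set G) : Prop :=
  forall n a, pi.-nat n -> H a -> exists2 x, H x & x ^+ n = a.

Definition pi_complete (pi : nat_pred) (G : groupType) (H : set G) : Prop :=
  pi_divisible pi H /\ pi_torsion_free pi H.

Definition pi_complete_nilpotent (pi : nat_pred) (G : groupType) (H : set G) :=
  [/\ subgroup H, nilpotent H & pi_complete pi H].

(** [K], with the embedding [iota], is a minimal [pi]-complete nilpotent group
    containing [G]. *)
Definition pi_completion (pi : nat_pred) (G K : groupType) (iota : hom G K) : Prop :=
  [/\ injective iota,
      pi_complete_nilpotent pi [set: K] &
      forall H : set K, pi_complete_nilpotent pi H -> range iota `<=` H ->
        H = [set: K]].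

(** [T'_G] and [T''_G]; an intersection over no homomorphism cannot occur, the
    trivial one always being in [T'_G]. *)
Definition solutions (F G : groupType) (T : set F) : set (hom F G) :=
  [set phi | T `<=` ker phi].
Arguments solutions {F} G T.

Definition radical (F G : groupType) (T : set F) : set F :=
  \bigcap_(phi in solutions G T) ker phi.

Definition geometrically_equivalent (G1 G2 : groupType) : Prop :=
  forall (X : finType) (T : set (free_group X)), radical G1 T = radical G2 T.

(* Main.v *)
(** An endomorphism [a] of a group that is the [n]-th power map modulo
    commutators is the power map of exponent [n ^ i] on the [i]-th lower central
    factor. Three consequences, for a [pi]-number [n]: [a] is injective on
    nilpotent [pi]-torsion-free groups; on a group of class [c], all values of its
    [c]-th iterate are [n]-th powers; and on a free group, every element has,
    modulo any lower central term, an [n ^ k]-th power in the image of [a].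

    Given [phi : F -> Ghat], choose [n] with every [phi x ^+ n] in [G], say equal to
    [h x]. As [G] is relatively free, it has an endomorphism [a] with
    [x |-> x ^+ n] on free generators; let [b] be the iterate of [a] whose values
    are [n]-th powers, and let [psi : F -> G] send [x] to an [n]-th root of
    [b (h x)]. Each [u] in [F] has a [pi]-power at which [phi] and [psi] take the
    values [w] and [b w] for one [w] in [G], so [phi] and [psi] have the same
    kernel. *)
Require Import Defs.
From HB Require Import structures.
From mathcomp Require Import all_boot.
From mathcomp Require Import boolp classical_sets.

Set Implicit Arguments.
Unset Strict Implicit.
Unset Printing Implicit Defensive.

Local Open Scope group_scope.
Local Open Scope quotient_scope.
Local Open Scope classical_set_scope.

(** * Generated subgroups and commutator identities *)

Section Subgroups.
Variable G : groupType.
Implicit Types (A H M : set G) (x y z : G).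

Lemma generated_min A H : subgroup H -> A `<=` H -> generated A `<=` H.
Proof. by move=> sgH sAH; apply: smallest_sub. Qed.

Lemma sub_generated A : A `<=` generated A.
Proof. exact: sub_smallest. Qed.

Lemma subgroup_generated A : subgroup (generated A).
Proof.
split=> [H [[]]//|x y Ax Ay H sAH|x Ax H sAH]; have [[_ HM HV] _] := sAH.
  by apply: HM; [apply: Ax | apply: Ay].
by apply: HV; apply: Ax.
Qed.

Lemma subgroupX H : subgroup H -> forall x n, H x -> H (x ^+ n).
Proof.
case=> H1 HM _ x + Hx; elim=> [//|n IHn]; rewrite expgS; exact: HM.
Qed.

Lemma subgroup_preimage (K : groupType) (f : hom G K) (H : set K) :
  subgroup H -> subgroup (f @^-1` H).
Proof.
case=> H1 HM HV; split=> [|x y|x]; rewrite /preimage /=.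
- by rewrite gmulf1.
- by rewrite gmulfM; apply: HM.
- by rewrite gmulfV; apply: HV.
Qed.

Lemma subgroup_range (K : groupType) (f : hom K G) : subgroup (range f).
Proof.
split=> [|_ _ [x _ <-] [y _ <-]|_ [x _ <-]].
- by exists 1; rewrite ?gmulf1.
- by exists (x * y); rewrite ?gmulfM.
- by exists x^-1; rewrite ?gmulfV.
Qed.

Lemma subgroup_centralizer x : subgroup [set y | commute x y].
Proof.
split=> [|y z|y] /=; [exact: commute1 | exact: commuteM | exact: commuteV].
Qed.

Lemma comm_commMl x y z :
  commute [~ x, z] y -> [~ x * y, z] = [~ x, z] * [~ y, z].
Proof.
move=> cxzy; have -> : [~ x * y, z] = [~ x, z] ^ y * [~ y, z].
  by rewrite /commg /conjg !gnorm.
by have /commgP/conjg_fixP-> := cxzy.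
Qed.

Lemma comm_commMr x y z :
  commute [~ x, y] z -> [~ x, y * z] = [~ x, z] * [~ x, y].
Proof.
move=> cxyz; have -> : [~ x, y * z] = [~ x, z] * [~ x, y] ^ z.
  by rewrite /commg /conjg !gnorm.
by have /commgP/conjg_fixP-> := cxyz.
Qed.

Lemma comm_commXl x y n :
  commute [~ x, y] x -> [~ x ^+ n, y] = [~ x, y] ^+ n.
Proof.
move=> cxyx; elim: n => [|n IHn]; first by rewrite !expg0 comm1g.
by rewrite !expgS comm_commMl ?IHn //; apply: commuteX.
Qed.

Lemma comm_commXr x y n :
  commute [~ x, y] y -> [~ x, y ^+ n] = [~ x, y] ^+ n.
Proof.
move=> cxyy; elim: n => [|n IHn]; first by rewrite !expg0 commg1.
by rewrite expgS expgSr comm_commMr ?IHn //; apply: commuteX.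
Qed.

(** Conjugation by [x] or [y] multiplies [z] by a central factor, so [x * y] and [y * x] conjugate
    [z] alike, and their quotient [[~ x, y]] fixes [z]. *)
Lemma commute_commg z x y :
    (forall g, commute [~ z, x] g) -> (forall g, commute [~ z, y] g) ->
  commute z [~ x, y].
Proof.
move=> cx cy; apply/commgP/conjg_fixP.
have fix_ (a b : G) : commute a b -> a ^ b = a by move=> cab; apply/conjg_fixP/commgP.
have zxE : z ^ x = z * [~ z, x] by rewrite commgEl mulVKg.
have zyE : z ^ y = z * [~ z, y] by rewrite commgEl mulVKg.
have zxyE : z ^ (x * y) = z * [~ z, y] * [~ z, x].
  by rewrite conjgM zxE conjMg zyE fix_.
have zyxE : z ^ (y * x) = z * [~ z, y] * [~ z, x].
  by rewrite conjgM zyE conjMg zxE (fix_ _ _ (cy x)) -[RHS]mulgA (cy _) [RHS]mulgA.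
have := zxyE; rewrite commgC conjgM zyxE 2!conjMg.
by rewrite (fix_ _ _ (cx _)) (fix_ _ _ (cy _)) => /mulIg/mulIg.
Qed.

End Subgroups.

(** * Quotient by a normal subgroup *)

Section Quotient.
Variables (G : groupType) (M : set G).
Hypotheses (sgM : subgroup M) (nM : forall x g, M x -> M (x ^ g)).

Definition coset_rel (x y : G) := `[< M (x^-1 * y) >].

Lemma coset_relP x y : reflect (M (x^-1 * y)) (coset_rel x y).
Proof. exact: asboolP. Qed.

Lemma coset_rel_refl : reflexive coset_rel.
Proof. by move=> x; apply/coset_relP; rewrite mulVg; case: sgM. Qed.

Lemma coset_rel_sym : symmetric coset_rel.
Proof.
suff H x y : coset_rel x y -> coset_rel y x.
  by move=> x y; apply/idP/idP; apply: H.
case: sgM => _ _ MV /coset_relP/MV; rewrite invgM invgK => Mxy.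
exact/coset_relP.
Qed.

Lemma coset_rel_trans : transitive coset_rel.
Proof.
case: sgM => _ MM _ y x z /coset_relP Mxy /coset_relP Myz; apply/coset_relP.
by rewrite -(mulgK y x^-1) -mulgA; apply: MM.
Qed.

Definition coset_equiv :=
  EquivRel coset_rel coset_rel_refl coset_rel_sym coset_rel_trans.

Definition cosets := {eq_quot coset_equiv}.
HB.instance Definition _ := EqQuotient.on cosets.
HB.instance Definition _ := Choice.on cosets.

Lemma coset_eqP (x y : G) : \pi_cosets x = \pi y <-> M (x^-1 * y).
Proof. by split=> [/eqmodP/coset_relP//|?]; apply/eqmodP/coset_relP. Qed.

Definition coset_mul (A B : cosets) : cosets := \pi_cosets (repr A * repr B).
Definition coset_inv (A : cosets) : cosets := \pi_cosets (repr A)^-1.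

Lemma pi_mul (x y : G) : coset_mul (\pi_cosets x) (\pi_cosets y) = \pi_cosets (x * y).
Proof.
apply/coset_eqP; case: sgM => _ MM _.
case: piP => x' /coset_eqP Mx; case: piP => y' /coset_eqP My.
have {My}My : M (y'^-1 * y).
  by case: sgM => _ _ MV; rewrite -[y'^-1 * y]invgK invgM invgK; apply: MV.
have {Mx}Mx : M (x'^-1 * x).
  by case: sgM => _ _ MV; rewrite -[x'^-1 * x]invgK invgM invgK; apply: MV.
have -> : (x' * y')^-1 * (x * y) = (x'^-1 * x) ^ y' * (y'^-1 * y).
  by rewrite /conjg !gnorm.
by apply: MM => //; apply: nM.
Qed.

Lemma pi_inv (x : G) : coset_inv (\pi_cosets x) = \pi_cosets x^-1.
Proof.
apply/coset_eqP; case: piP => x' /coset_eqP Mx.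
have -> : (x'^-1)^-1 * x^-1 = ((x^-1 * x') ^ x^-1) by rewrite /conjg !gnorm.
exact: nM.
Qed.

Lemma cosetE (A : cosets) : exists x, A = \pi_cosets x.
Proof. by exists (repr A); rewrite reprK. Qed.

Let one : cosets := \pi_cosets 1.

Lemma coset_mulA : associative coset_mul.
Proof.
move=> A B C; case: (cosetE A) (cosetE B) (cosetE C) => x -> [y ->] [z ->].
by rewrite !pi_mul mulgA.
Qed.
Lemma coset_mul1 : left_id one coset_mul.
Proof. by move=> A; case: (cosetE A) => x ->; rewrite pi_mul mul1g. Qed.
Lemma coset_mulr1 : right_id one coset_mul.
Proof. by move=> A; case: (cosetE A) => x ->; rewrite pi_mul mulg1. Qed.
Lemma coset_mulV : left_inverse one coset_inv coset_mul.
Proof. by move=> A; case: (cosetE A) => x ->; rewrite pi_inv pi_mul mulVg. Qed.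
Lemma coset_mulrV : right_inverse one coset_inv coset_mul.
Proof. by move=> A; case: (cosetE A) => x ->; rewrite pi_inv pi_mul mulgV. Qed.

HB.instance Definition _ :=
  isGroup.Build cosets coset_mulA coset_mul1 coset_mulr1 coset_mulV coset_mulrV.

Definition coset_pi (x : G) : cosets := \pi_cosets x.

Lemma coset_pi_morph : monoid_morphism coset_pi.
Proof. by split=> // x y; rewrite /coset_pi -pi_mul. Qed.

HB.instance Definition _ :=
  isUMagmaMorphism.Build G cosets coset_pi coset_pi_morph.

Lemma quotient_hom :
  exists (Q : groupType) (q : hom G Q),
    (forall A, exists x, A = q x) /\ forall x y, q x = q y <-> M (x^-1 * y).
Proof. by exists cosets, coset_pi; split; [exact: cosetE | exact: coset_eqP]. Qed.

End Quotient.

(** * Lower central series, with [L 0] the whole group *)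

Section LowerCentral.
Variable G : groupType.
Implicit Types (x y z g : G) (i : nat).

Local Notation L := (lower_central [set: G]).

Lemma subgroup_lower_central i : subgroup (L i).
Proof. by case: i => [|i]; [split | apply: subgroup_generated]. Qed.

Lemma lower_central_comm i x y : L i x -> L i.+1 [~ x, y].
Proof. by move=> Lx; apply: sub_generated; exists x, y. Qed.

Lemma lower_central_sub i : L i.+1 `<=` L i.
Proof.
elim: i => [//|i IHi]; apply: generated_min => [|_ [x [y [/IHi Lx _ ->]]]].
  exact: subgroup_lower_central.
exact: lower_central_comm.
Qed.

Lemma lower_central_normal i x g : L i x -> L i (x ^ g).
Proof.
move=> Lx; have -> : x ^ g = x * [~ x, g] by rewrite commgEl mulVKg.
have [_ LM _] := subgroup_lower_central i.
by apply: LM => //; apply: lower_central_sub; apply: lower_central_comm.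
Qed.

(** Lets congruences modulo [L i.+1] be computed as equations in [Q], where factors from [L i] move
    freely. *)
Lemma lower_central_quotient i :
  exists (Q : groupType) (q : hom G Q),
    (forall x y, q x = q y <-> L i.+1 (x^-1 * y)) /\
    (forall z A, L i z -> commute (q z) A).
Proof.
have [Q [q [qE qP]]] := quotient_hom (subgroup_lower_central i.+1)
  (@lower_central_normal i.+1).
exists Q, q; split=> // z A Lz; have [g ->] := qE A; apply/commgP; rewrite -gmulfR; apply/eqP.
rewrite -[RHS](@gmulf1 _ _ q); apply/esym/qP; rewrite invg1 mul1g.
exact: lower_central_comm.
Qed.

End LowerCentral.

Lemma hom_lower_central (G K : groupType) (f : hom G K) i x :
  lower_central [set: G] i x -> lower_central [set: K] i (f x).
Proof.
elim: i x => [//|i IHi]; apply: generated_min => [|_ [x [y [/IHi Lx _ ->]]]].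
  exact: (subgroup_preimage _ (subgroup_lower_central _ _)).
by rewrite /preimage /= gmulfR; apply: lower_central_comm.
Qed.

(** * Endomorphisms that are power maps modulo commutators *)

Section PowerEndomorphism.
Variables (G : groupType) (a : hom G G) (n : nat).
Local Notation L := (lower_central [set: G]).
Hypothesis a_pow : forall g, L 1 ((g ^+ n)^-1 * a g).

(** Since commutators are bilinear modulo the next term, [a] acts on the [i]-th
    lower central factor, counted from [0], as the power map of exponent
    [n ^ i.+1]. *)
Lemma power_endo_graded i g : L i g -> L i.+1 ((g ^+ (n ^ i.+1))^-1 * a g).
Proof.
elim: i g => [|i IHi] g; first by rewrite expn1.
have [Q [q [qP qC]]] := lower_central_quotient G i.+1.
move=> Lg; apply/qP; rewrite gmulfXn; move: g Lg.
have qL z g h : L i z -> commute [~ q z, q g] h.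
  by move=> Lz; rewrite -gmulfR; apply: qC; apply: lower_central_comm.
(* [L 1] is generated by commutators, and [commute_commg] handles each: [[~ z, g]] lies in [L i.+1],
   whose image in [Q] is central. *)
have cLd z d : L i z -> L 1 d -> commute (q z) (q d).
  move=> Lz; have sg := subgroup_preimage q (subgroup_centralizer (q z)).
  move: d; apply: (generated_min sg) => _ [x [y [_ _ ->]]].
  by rewrite /preimage /= gmulfR; apply: commute_commg => h; apply: qL.
pose H := L i.+1 `&` [set g | q g ^+ (n ^ i.+2) = q (a g)].
suff: L i.+1 `<=` H by move=> LH g /LH[].
have [L1 LM LV] := subgroup_lower_central G i.+1.
apply: generated_min => [|_ [x [y [Lx _ ->]]]].
  split=> [|x y [Lx xE] [Ly yE]|x [Lx xE]]; split; rewrite /= ?gmulf1 ?expg1n //.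
  - exact: LM.
  - by rewrite !gmulfM expgMn ?xE ?yE //; apply: qC.
  - exact: LV.
  - by rewrite !gmulfV expVgn xE.
split; rewrite /=; first exact: lower_central_comm.
(* With [a x = x ^+ N * c] and [a y = y ^+ n * d], in [Q] the image of [c] is central and that of
   [d] commutes with that of [x ^+ N], so only [[~ x ^+ N, y ^+ n]] survives. *)
set N := (n ^ i.+1)%N; have Lax := IHi x Lx; have Lay := a_pow y.
set c := _ * a x in Lax; set d := _ * a y in Lay.
rewrite [a _]gmulfR; have -> : a x = x ^+ N * c by rewrite mulVKg.
have -> : a y = y ^+ n * d by rewrite mulVKg.
have LxN : L i (x ^+ N) by apply: subgroupX Lx; apply: subgroup_lower_central.
have comm1 (A B : Q) : commute A B -> [~ A, B] = 1 by move=> /commgP/eqP.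
rewrite !gmulfR [q (_ * c)]gmulfM [q (_ * d)]gmulfM comm_commMl; last first.
  by apply: commute_sym; apply: qC.
rewrite (comm1 (q c)) ?mulg1; last exact: qC.
rewrite comm_commMr; last by rewrite [q (y ^+ n)]gmulfXn -gmulfXn; apply: qL.
rewrite (comm1 _ (q d)) ?mul1g; last exact: cLd.
rewrite [q (y ^+ n)]gmulfXn comm_commXr; last exact: qL.
rewrite gmulfXn comm_commXl; last exact: qL.
by rewrite -expgnA -expnSr.
Qed.

(** Applying [a] to an error [k] in [L i] gives [k ^+ (n ^ i.+1)] modulo [L i.+1]: an [n]-th power
    of an element central there, hence absorbed into the root. *)
Lemma power_endo_root i g : exists v, L i ((v ^+ n)^-1 * iter i a g).
Proof.
elim: i => [|i [v Lv]]; first by exists 1.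
have [Q [q [qP qC]]] := lower_central_quotient G i.
set k := _ * _ in Lv; have -> : iter i.+1 a g = a (v ^+ n * k) by rewrite mulVKg.
clearbody k; exists (a v * k ^+ (n ^ i)); apply/qP; rewrite gmulfM [in RHS]gmulfM.
have <- : q (k ^+ (n ^ i.+1)) = q (a k) by apply/qP; apply: power_endo_graded.
rewrite !(gmulfXn, gmulfM) expgMn -?expgnA -?expnSr //.
by apply: commuteX; apply: commute_sym; apply: qC.
Qed.

(** An error [z] in [L i] is central modulo [L i.+1]; raising the congruence to the power [n ^ i.+1]
    turns [z] into [a z], which joins the image of [a]. *)
Lemma power_endo_isolator i u :
  exists k v, L i ((a v)^-1 * u ^+ (n ^ k)).
Proof.
elim: i => [|i [k [v]]]; first by exists 0, 1.
have [Q [q [qP qC]]] := lower_central_quotient G i.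
set z := _ * _ => Lz; exists (k + i.+1)%N, (v ^+ (n ^ i.+1) * z); apply/qP.
rewrite expnD expgnA; have -> : u ^+ (n ^ k) = a v * z by rewrite mulVKg.
clearbody z; have qaz : q (z ^+ (n ^ i.+1)) = q (a z) by apply/qP; apply: power_endo_graded.
rewrite !gmulfXn !gmulfM -qaz !gmulfXn expgMn //.
by apply: commute_sym; apply: qC.
Qed.

(** If [a] kills [g], it kills any power of [g] lying in [L i], whose [n ^ i.+1]-th power then lies
    in [L i.+1]. So some [n ^ k]-th power of [g] is trivial. *)
Lemma power_endo_inj (pi : nat_pred) : pi.-nat n ->
  nilpotent [set: G] -> pi_torsion_free pi [set: G] -> forall g, a g = 1 -> g = 1.
Proof.
move=> pin [c Lc] tfG g ag1.
have pow i : exists k, L i (g ^+ (n ^ k)).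
  elim: i => [|i [k Lk]]; first by exists 0.
  exists (k + i.+1)%N; have := power_endo_graded Lk.
  rewrite gmulfXn ag1 expg1n mulg1 -expgnA -expnD.
  by have [_ _ LV] := subgroup_lower_central G i.+1; move/LV; rewrite invgK.
have [k] := pow c; rewrite Lc => /= gk.
by apply: tfG gk => //; rewrite pnatX pin.
Qed.

End PowerEndomorphism.

(** * Power endomorphisms of free and relatively free groups *)

Section FreeGroups.
Variable X : choiceType.

Lemma free_group_ind (H : set (free_group X)) :
  subgroup H -> (forall x, H (fg_gen x)) -> H = [set: free_group X].
Proof.
case=> H1 HM HV Hgen; apply/seteqP; split=> // -[w rw] _.
elim: w rw => [|[x b] w IHw] rw.
  by have -> : FreeGroup rw = 1 by apply: val_inj.
have rw' : reduced w by exact: path_sorted rw.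
have -> : FreeGroup rw = (if b then (fg_gen x)^-1 else fg_gen x) * FreeGroup rw'.
  by apply: val_inj; rewrite -[LHS](push_cons rw); case: (b).
by apply: HM (IHw _); case: (b); [apply: HV|].
Qed.

Lemma free_hom_ext (G : groupType) (f g : hom (free_group X) G) :
  (forall x, f (fg_gen x) = g (fg_gen x)) -> f =1 g.
Proof.
by move=> fg u; rewrite (fg_lift_unique fg) -(fg_lift_unique (fun=> erefl)).
Qed.

Definition pow_gen n : hom (free_group X) (free_group X) :=
  fg_lift (fun x => fg_gen x ^+ n).

Lemma pow_genE n x : pow_gen n (fg_gen x) = fg_gen x ^+ n.
Proof. exact: fg_lift_gen. Qed.

(** Modulo commutators the [n]-th power map is a homomorphism, so generators decide. *)
Lemma pow_gen_pow n u :
  lower_central [set: free_group X] 1 ((u ^+ n)^-1 * pow_gen n u).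
Proof.
have [Q [q [qP qC]]] := lower_central_quotient (free_group X) 0.
pose H := [set u | q u ^+ n = q (pow_gen n u)].
suff HT : H = setT by apply/qP; rewrite gmulfXn; have : setT u by []; rewrite -HT.
apply: free_group_ind => [|x]; last by rewrite /H /= pow_genE gmulfXn.
split=> [|x y xE yE|x xE]; rewrite /H /=.
- by rewrite !gmulf1 expg1n.
- by rewrite !gmulfM expgMn ?xE ?yE //; apply: qC.
- by rewrite !gmulfV expVgn xE.
Qed.

End FreeGroups.

(** A verbal subgroup is stable under every endomorphism, so [pow_gen X n] descends along [p]. *)
Lemma relatively_free_pow (G : groupType) n : relatively_free G ->
  exists a : hom G G, forall g,
    lower_central [set: G] 1 ((g ^+ n)^-1 * a g).
Proof.
case=> X [W [p [p_onto kerp]]]; have [s sK] := choice p_onto.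
pose t := pow_gen X n.
have verbt : verbal (free_group X) W `<=` t @^-1` verbal (free_group X) W.
  have sgV := subgroup_preimage t (subgroup_generated _).
  apply: (generated_min (sgV _)) => _ [f [w [Ww ->]]]; apply: sub_generated.
  by exists (t \o f : hom _ _), w.
have pt u v : p u = p v -> p (t u) = p (t v).
  move=> puv; suff : ker p (t (u^-1 * v)).
    by rewrite /ker /= gmulfM gmulfV gmulfM gmulfV => /mulg1_eq; rewrite invgK.
  rewrite kerp; apply: verbt; rewrite -kerp /ker /=.
  by rewrite gmulfM gmulfV puv mulVg.
have a_morph : monoid_morphism (fun g => p (t (s g))).
  split=> [|g h]; last by rewrite -!gmulfM; apply: pt; rewrite gmulfM !sK.
  by rewrite -(@gmulf1 _ _ p) -(@gmulf1 _ _ t); apply: pt; rewrite sK gmulf1.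
pose am := isUMagmaMorphism.Build G G _ a_morph.
pose a : hom G G := HB.pack (fun g => p (t (s g))) am.
exists a => g; have := hom_lower_central p (pow_gen_pow n (s g)).
by rewrite gmulfM gmulfV gmulfXn sK.
Qed.

(** * Isolators and the completion *)

Section Completion.
Variable pi : nat_pred.

Lemma relatively_free_root_endo (G : groupType) n :
    relatively_free G -> nilpotent [set: G] -> pi_torsion_free pi [set: G] ->
    pi.-nat n ->
  exists b : hom G G,
    (forall g, b g = 1 -> g = 1) /\ (forall g, exists v, v ^+ n = b g).
Proof.
move=> rfG nilG tfG pin; have [a a_pow] := relatively_free_pow n rfG.
have [c Lc] := nilG.
have [b bE] : exists b : hom G G, b =1 iter c a.
  elim: c {Lc} => [|c [b bE]]; first by exists (idfun : hom G G).
  by exists (a \o b : hom G G) => g /=; rewrite bE.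
exists b; split=> g.
  rewrite bE; elim: c {Lc bE} => [//|c IHc] /= acg; apply: IHc.
  exact: (power_endo_inj a_pow pin nilG tfG) acg.
have [v] := power_endo_root a_pow c g.
by rewrite Lc bE => /= /mulg1_eq; rewrite invgK; exists v.
Qed.

(** The product of all the exponents serves every [x]; finite rank enters here. *)
Lemma finite_common_power (X : finType) (K : groupType) (H : set K) (f : X -> K) :
    subgroup H -> (forall x, exists m, pi.-nat m /\ H (f x ^+ m)) ->
  exists n, pi.-nat n /\ forall x, H (f x ^+ n).
Proof.
move=> sgH /choice[m mP]; exists (\prod_x m x)%N; split=> [|x].
  apply: (big_ind (fun n => pi.-nat n)) => [//|k l kP lP|x _].
    by rewrite pnatM kP.
  by have [] := mP x.
rewrite (bigD1 x) //= expgnA; apply: subgroupX => //.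
by have [] := mP x.
Qed.

(** The congruence is solved once in the free group, and its error dies in [K]. Hence [k] and [v] do
    not depend on [f], which allows two homomorphisms to be compared. *)
Lemma free_pow_isolator (X : choiceType) (K : groupType) n c
    (u : free_group X) : lower_central [set: K] c = [set 1] ->
  exists k v, forall f : hom (free_group X) K,
    f u ^+ (n ^ k) = f (pow_gen X n v).
Proof.
move=> Lc; have [k [v Lv]] := power_endo_isolator (pow_gen_pow n) c u.
exists k, v => f; have := hom_lower_central f Lv.
by rewrite Lc /= gmulfM gmulfV gmulfXn => /mulg1_eq; rewrite invgK.
Qed.

Definition isolator (K : groupType) (H : set K) : set K :=
  [set y | exists n, pi.-nat n /\ H (y ^+ n)].

(** For products, choose [n] with [x ^+ n] and [y ^+ n] in [H]; some [n ^ k]-th power of [x * y] is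
    then the value of a word in these two elements. *)
Lemma subgroup_isolator (K : groupType) (H : set K) :
  nilpotent [set: K] -> subgroup H -> subgroup (isolator H).
Proof.
move=> [c Lc] sgH; have [H1 HM HV] := sgH.
split=> [|x y Ix Iy|x [n [pin Hx]]]; last 1 first.
- by exists n; split=> //; rewrite expVgn; apply: HV.
- by exists 1%N; rewrite expg1n.
pose f : hom (free_group bool) K := fg_lift (fun b => if b then x else y).
have fE b : f (fg_gen b) = if b then x else y by exact: fg_lift_gen.
have [|n [pin Hf]] := @finite_common_power bool K H
  (fun b => if b then x else y) sgH; first by case.
have [k [v kv]] := free_pow_isolator n (fg_gen true * fg_gen false) Lc.
exists (n ^ k)%N; split; first by rewrite pnatX pin.
have := kv f; rewrite gmulfM !fE => ->.
pose g : hom (free_group bool) K := f \o pow_gen _ n.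
have HT : g @^-1` H = setT.
  apply: free_group_ind => [|b]; first exact: subgroup_preimage.
  by rewrite /preimage /= pow_genE gmulfXn fE.
by have : setT v by []; rewrite -HT.
Qed.

Lemma lower_central_subset (K : groupType) (H H' : set K) i :
  H `<=` H' -> lower_central H i `<=` lower_central H' i.
Proof.
move=> sHH'; elim: i => [//|i IHi]; apply: generated_min.
  exact: subgroup_generated.
move=> _ [x [y [Lx Hy ->]]]; apply: sub_generated.
by exists x, y; split; [apply: IHi | apply: sHH' |].
Qed.

Lemma nilpotent_subgroup (K : groupType) (H : set K) :
  nilpotent [set: K] -> subgroup H -> nilpotent H.
Proof.
move=> [c Lc] sgH; exists c; apply/seteqP; split=> [x|_ ->].
  by move=> /(@lower_central_subset _ _ [set: K]); rewrite Lc; apply.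
case: c {Lc} => [|c]; first by case: sgH.
by have [] := subgroup_generated
  [set g | exists x y, [/\ lower_central H c x, H y & g = [~ x, y]]].
Qed.

(** Turns minimality into existence of [pi]-powers in [G]: the isolator of the image is already
    [pi]-complete, because a root in [K] of one of its elements stays in it. *)
Lemma pi_completion_isolator (G K : groupType) (iota : hom G K) :
  pi_completion pi iota -> isolator (range iota) = [set: K].
Proof.
move=> [_ [_ nilK [divK tfK]] minK]; apply: minK; last first.
  by move=> y ry; exists 1%N.
have sgI := subgroup_isolator nilK (subgroup_range iota).
split=> //; first exact: nilpotent_subgroup.
split=> [n y pin [m [pim ry]]|n y pin _]; last exact: tfK.
have [x _ xy] := divK n y pin I; exists x => //.
by exists (n * m)%N; rewrite pnatM pin expgnA xy.
Qed.

(** Radicals are intersections of kernels, so matching kernels is enough to compare [G] with [K]. *)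
Lemma pi_completion_specialize (G K : groupType) (iota : hom G K) (X : finType) :
    relatively_free G -> nilpotent [set: G] -> pi_torsion_free pi [set: G] ->
    pi_completion pi iota ->
  forall phi : hom (free_group X) K, exists psi : hom (free_group X) G,
    ker psi = ker phi.
Proof.
move=> rfG nilG tfG complK phi.
have [iota_inj [_ [c Lc] [_ tfK]] _] := complK.
have [|n [pin powG]] := @finite_common_power X K _ (phi \o @fg_gen X)
    (subgroup_range iota).
  move=> x; have : [set: K] (phi (fg_gen x)) by [].
  by rewrite -(pi_completion_isolator complK).
have /choice[h hE] : forall x, exists g, iota g = phi (fg_gen x) ^+ n.
  by move=> x; have [g _ gE] := powG x; exists g.
have [b [b_inj /choice[r rE]]] := relatively_free_root_endo rfG nilG tfG pin.
pose chi : hom (free_group X) G := fg_lift h.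
pose psi : hom (free_group X) G := fg_lift (r \o h).
have chi_gen x : chi (fg_gen x) = h x by exact: fg_lift_gen.
have psi_gen x : psi (fg_gen x) = r (h x) by exact: fg_lift_gen.
clearbody chi psi.
have phiE v : phi (pow_gen X n v) = iota (chi v).
  move: v; apply: (@free_hom_ext _ _ (phi \o pow_gen X n) (iota \o chi)) => x /=.
  by rewrite pow_genE gmulfXn chi_gen hE.
have psiE v : psi (pow_gen X n v) = b (chi v).
  move: v; apply: (@free_hom_ext _ _ (psi \o pow_gen X n) (b \o chi)) => x /=.
  by rewrite pow_genE gmulfXn psi_gen chi_gen rE.
exists psi; apply/seteqP; split=> u; rewrite /ker /=.
all: have [k [v kv]] := free_pow_isolator n u Lc.
all: have pink : pi.-nat (n ^ k)%N by rewrite pnatX pin.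
all: have phiu : phi u ^+ (n ^ k) = iota (chi v) by rewrite kv; apply: phiE.
(* [kv] concerns homomorphisms into [K], so [psi] is first composed with [iota]. *)
all: have psiu : psi u ^+ (n ^ k) = b (chi v)
       by rewrite -psiE; apply: iota_inj; rewrite gmulfXn (kv (iota \o psi)).
(* As [b] and [iota] are injective and [G], [K] are [pi]-torsion-free, [psi u] and [phi u] are each
   trivial exactly when [chi v] is. *)
- move=> psi1; apply: tfK pink _ _ => //; rewrite phiu.
  by rewrite (b_inj (chi v)) ?gmulf1 // -psiu psi1 expg1n.
- move=> phi1; apply: tfG pink _ _ => //; rewrite psiu.
  have /eqP := phiu; rewrite phi1 expg1n eq_sym gmulf_eq1 // => /eqP ->.
  exact: gmulf1.
Qed.

End Completion.

Theorem theorem3p15 (pi : nat_pred) (pi_primes : forall p, p \in pi -> prime p)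
    (pi_nonempty : exists p, p \in pi)
    (G : groupType) (G_relfree : relatively_free G)
    (G_nilpotent : nilpotent [set: G]%classic)
    (G_torsion_free : pi_torsion_free pi [set: G]%classic)
    (Ghat : groupType) (iota : hom G Ghat) (Ghat_completion : pi_completion pi iota) :
  geometrically_equivalent G Ghat.
Proof.
move=> X T; apply/seteqP; split=> u radu phi Tphi.
  have [psi kerE] := pi_completion_specialize G_relfree G_nilpotent
    G_torsion_free Ghat_completion phi.
  by rewrite -kerE; apply: radu; rewrite /solutions /= kerE.
(* For the converse inclusion, composing with the injective [iota] preserves kernels. *)
have [iota_inj _ _] := Ghat_completion.
have kerE : ker (iota \o phi) = ker phi.
  apply/seteqP; split=> x; rewrite /ker /=; last by move=> ->; apply: gmulf1.
  by move=> /eqP; rewrite gmulf_eq1 // => /eqP.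
by rewrite -kerE; apply: radu; rewrite /solutions /= kerE.
Qed.
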